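(* Let $d\in\{2,3\}$, $r_s>0$ and $0<\delta<0.75$. Let robot $i$ have random position $\mathbf{p}_i\sim\mathcal{N}(\hat{\mathbf{p}}_i,\Sigma_i)$ in $\mathbb{R}^d$, and let $o$ be an uncertain obstacle $\mathcal{O}_o=\{\mathbf{x}+\mathbf{d}_o:\mathbf{x}\in\hat{\mathcal{O}}_o\}$ with $\hat{\mathcal{O}}_o\subset\mathbb{R}^d$ a bounded convex polytope and $\mathbf{d}_o\sim\mathcal{N}(0,\Sigma_o)$ ($\Sigma_o$ positive definite), with $\mathbf{d}_o$ independent of $\mathbf{p}_i$. Let $(\mathbf{a}_{io},b_{io})$ be the robot-obstacle uncertainty-aware separating hyperplane constructed as in the context, and suppose $\hat{\mathbf{p}}_i\in\mathcal{V}_i^{u,b}$ (so in particular $\mathbf{a}_{io}^T\hat{\mathbf{p}}_i\le b_{io}-r_s\|\mathbf{a}_{io}\|-\sqrt{2\mathbf{a}_{io}^T\Sigma_i\mathbf{a}_{io}}\,\mathrm{erf}^{-1}(2\sqrt{1-\delta}-1)$). Then $$\Pr\big(\mathrm{dis}(\mathbf{p}_i,\mathcal{O}_o)\ge r_s\big)\ge 1-\delta,$$ where $\mathrm{dis}(\mathbf{p},\mathcal{O})=\min_{\mathbf{q}\in\mathcal{O}}\|\mathbf{p}-\mathbf{q}\|$.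
   Context: Construction of $(\mathbf{a}_{io},b_{io})$: let $W=(\sqrt{\Sigma_o})^{-1}$, $\hat{\mathbf{p}}_i^W=W\hat{\mathbf{p}}_i$, $\hat{\mathcal{O}}_o^W=W\hat{\mathcal{O}}_o$ (so $W\mathbf{d}_o\sim\mathcal{N}(0,I)$). Let $\epsilon=1-\sqrt{1-\delta}$ and $F^{-1}$ the inverse CDF of the chi-squared distribution with $d$ degrees of freedom. Let $\mathcal{S}_o^W$ be a convex polytope, obtained by dilating $\hat{\mathcal{O}}_o^W$, that contains the Minkowski sum $\hat{\mathcal{O}}_o^W+\{\mathbf{d}:\mathbf{d}^T\mathbf{d}\le F^{-1}(1-\epsilon)\}$, with vertices $\psi_1^W,\dots,\psi_{p_o}^W$ (assume $\hat{\mathbf{p}}_i^W\notin\mathcal{S}_o^W$). Solve the quadratic program $\min \|\mathbf{a}^W\|^2$ s.t. $(\mathbf{a}^W)^T\hat{\mathbf{p}}_i^W-b^W\le 1$ (stated as $-1$ side separation in SVM form) and $(\mathbf{a}^W)^T\psi_k^W-b^W\ge 1$ for all $k$, then shift the resulting hyperplane along its normal toward $\mathcal{S}_o^W$ until it touches $\mathcal{S}_o^W$, giving $(\mathbf{a}_{io}^W,b_{io}^W)$ with $\mathcal{S}_o^W\subseteq\{\mathbf{y}:(\mathbf{a}_{io}^W)^T\mathbf{y}\ge b_{io}^W\}$. Finally set $\mathbf{a}_{io}=W^T\mathbf{a}_{io}^W$, $b_{io}=b_{io}^W$. The B-UAVC of robot $i$ is $\mathcal{V}_i^{u,b}=\{\mathbf{p}:\mathbf{a}_{il}^T\mathbf{p}\le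 b_{il}-r_s\|\mathbf{a}_{il}\|-\sqrt{2\mathbf{a}_{il}^T\Sigma_i\mathbf{a}_{il}}\,\mathrm{erf}^{-1}(2\sqrt{1-\delta}-1)\ \forall l\neq i\}$, the intersection over all other robots and obstacles $l$ of such buffered half-spaces, with $\mathrm{erf}(x)=\frac{2}{\sqrt\pi}\int_0^xe^{-t^2}dt$. *)

(* Defs.v *)
From HB Require Import structures.
From mathcomp Require Import all_boot all_order all_algebra.
From mathcomp Require Import all_classical all_reals all_analysis.
Set Implicit Arguments. Unset Strict Implicit. Unset Printing Implicit Defensive.
Import Order.TTheory GRing.Theory Num.Theory.
Import numFieldNormedType.Exports.
Local Open Scope classical_set_scope.
Local Open Scope ring_scope.

Section Defs.
Context {R : realType}.

Definition dotv {n} (u v : 'cV[R]_n) : R := (u^T *m v) 0 0.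
Definition vnorm {n} (u : 'cV[R]_n) : R := Num.sqrt (dotv u u).

Definition symmx {n} (S : 'M[R]_n) := S^T = S.
Definition psdmx {n} (S : 'M[R]_n) := forall a : 'cV[R]_n, 0 <= dotv a (S *m a).
Definition pdmx {n} (S : 'M[R]_n) :=
  forall a : 'cV[R]_n, a != 0 -> 0 < dotv a (S *m a).

Definition conv_hull {n} (V : seq 'cV[R]_n) : set 'cV[R]_n :=
  [set x | exists w : 'I_(size V) -> R,
     (forall k, 0 <= w k) /\ \sum_k w k = 1 /\ x = \sum_k w k *: nth 0 V k].

Definition translate {n} (O : set 'cV[R]_n) (d : 'cV[R]_n) : set 'cV[R]_n :=
  [set x + d | x in O].

Definition minkowski_ball {n} (A : set 'cV[R]_n) (c : R) : set 'cV[R]_n :=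
  [set z | exists x u, A x /\ dotv u u <= c /\ z = x + u].

(* dis(p, O) = min_{q in O} ||p - q|| (an infimum, attained for compact O) *)
Definition dis {n} (p : 'cV[R]_n) (O : set 'cV[R]_n) : R :=
  inf [set vnorm (p - q) | q in O].

Definition erf (x : R) : R :=
  2 / Num.sqrt pi *
  (if 0 <= x then Rintegral lebesgue_measure `[0, x] (fun t => expR (- t ^+ 2))
   else - Rintegral lebesgue_measure `[x, 0] (fun t => expR (- t ^+ 2))).
Definition erf_inv (y : R) : R := xget 0 [set x | erf x = y].

Definition Gamma (s : R) : R :=
  Rintegral lebesgue_measure `[0, +oo[ (fun x => x `^ (s - 1) * expR (- x)).
Definition chi2_pdf (k : nat) (x : R) : R :=
  x `^ (k%:R / 2 - 1) * expR (- x / 2) / (2 `^ (k%:R / 2) * Gamma (k%:R / 2)).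
Definition chi2_cdf (k : nat) (t : R) : R :=
  Rintegral lebesgue_measure `[0, t] (chi2_pdf k).
Definition chi2_inv (k : nat) (p : R) : R :=
  xget 0 [set t | 0 <= t /\ chi2_cdf k t = p].

Definition gauss_law (m v : R) : set R -> \bar R :=
  if v == 0 then \d_m else normal_prob m (Num.sqrt v).

Definition gauss_vec (dT : measure_display) (T : measurableType dT)
    (P : probability T R) {n} (X : T -> 'cV[R]_n) (m : 'cV[R]_n) (S : 'M[R]_n) :=
  (forall j, measurable_fun setT (fun w => X w j 0)) /\
  forall (a : 'cV[R]_n) (A : set R), measurable A ->
    P ((fun w => dotv a (X w)) @^-1` A) = gauss_law (dotv a m) (dotv a (S *m a)) A.

(* independence of two random vectors (product rule on Borel boxes, which
   generate the Borel sigma-algebra of R^n) *)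
Definition indep_vec (dT : measure_display) (T : measurableType dT)
    (P : probability T R) {n} (X Y : T -> 'cV[R]_n) :=
  forall A B : 'I_n -> set R, (forall j, measurable (A j)) ->
    (forall j, measurable (B j)) ->
    let EX := [set w | forall j, A j (X w j 0)] in
    let EY := [set w | forall j, B j (Y w j 0)] in
    P (EX `&` EY) = (P EX * P EY)%E.

Definition qp_feasible {n} (pW : 'cV[R]_n) (psi : seq 'cV[R]_n)
    (a : 'cV[R]_n) (b : R) :=
  dotv a pW - b <= -1 /\ forall k, k \in psi -> 1 <= dotv a k - b.

Definition B_UAVC {n} (rs delta : R) (Si : 'M[R]_n)
    (H : seq ('cV[R]_n * R)) : set 'cV[R]_n :=
  [set p | forall ab, ab \in H ->
     dotv ab.1 p <= ab.2 - rs * vnorm ab.1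
        - Num.sqrt (2 * dotv ab.1 (Si *m ab.1))
          * erf_inv (2 * Num.sqrt (1 - delta) - 1)].

End Defs.

(* Main.v *)
(* The events "a_io separates the robot by r_s" and "the whole obstacle lies beyond
   the hyperplane" are half-space events for p and d_o respectively, hence
   independent, and each has probability at least s = sqrt (1 - delta); together
   they force dis >= r_s by Cauchy-Schwarz.
   For the robot this is the definition of erf^-1.  For the obstacle, in whitened
   coordinates the polytope keeps distance sqrt c from the hyperplane, where c is
   the s-quantile of the chi-squared law, so one needs chi2_cdf n c <= Phi (sqrt c).
   For n = 3 this follows from the closed form
   chi2_cdf 3 c = 2 Phi (u) - 1 - 2 u phi (u), u = sqrt c, and for n = 2 from the
   tail bound 1 - Phi (u) <= expR (- u^2 / 2) / 2. *)

Require Import Defs.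
From HB Require Import structures.
From mathcomp Require Import all_boot all_order all_algebra.
From mathcomp Require Import all_classical all_reals all_analysis.
From mathcomp Require Import measurable_realfun.
From mathcomp Require Import ring lra.
Import Order.TTheory GRing.Theory Num.Theory.
Import numFieldNormedType.Exports.
Local Open Scope classical_set_scope.
Local Open Scope ring_scope.

(** * The Gaussian distribution function *)

(* Not normalized: the limit at +oo is [Num.sqrt pi]. *)
Definition gauss_cdf {R : realType} (x : R) : R :=
  Rintegral lebesgue_measure `]-oo, x] gauss_fun.

Lemma gauss_integrable {R : realType} (A : set R) : measurable A ->
  lebesgue_measure.-integrable A (EFin \o @gauss_fun R).
Proof. by move=> mA; apply: integrableS integrableT_gauss. Qed.

Lemma gauss_cdf_is_derive {R : realType} (x : R) :
  is_derive x 1 gauss_cdf (gauss_fun x).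
Proof.
have x1 : x < x + 1 by rewrite ltrDl.
have xy : (-oo < x%:E)%E by rewrite ltNyr.
have [] := @continuous_FTC1 R gauss_fun -oo%O x _ x1 (gauss_integrable _ (measurable_itv _)) xy
  (@continuous_gauss_fun R x).
rewrite -/gauss_cdf => dx Ex; apply: DeriveDef; [exact: dx|by rewrite -derive1E].
Qed.

Lemma gauss_cdf_continuous {R : realType} : continuous (@gauss_cdf R).
Proof.
move=> x; apply: differentiable_continuous; apply/derivable1_diffP.
by have [] := gauss_cdf_is_derive x.
Qed.

Lemma gauss_cdfB {R : realType} (x y : R) : x <= y ->
  gauss_cdf y - gauss_cdf x = Rintegral lebesgue_measure `[x, y] gauss_fun.
Proof.
move=> xy; rewrite -Rintegral_itv_obnd_cbnd; last exact: gauss_integrable.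
by rewrite -(@Rintegral_itvB R gauss_fun -oo%O) //; exact: gauss_integrable.
Qed.

Lemma gauss_cdf_nondecreasing {R : realType} (x y : R) : x <= y ->
  gauss_cdf x <= gauss_cdf y.
Proof.
move=> xy; rewrite -subr_ge0 gauss_cdfB //.
by apply: Rintegral_ge0 => //= z _; exact: gauss_fun_ge0.
Qed.

(** The reflection [x -> - x] carries the left half-line to the right one, where the Gaussian
    integral is known. *)
Lemma gauss_cdf0 {R : realType} : gauss_cdf 0 = Num.sqrt pi / 2 :> R.
Proof.
rewrite /gauss_cdf /Rintegral -[in `]-oo, 0]]oppr0.
rewrite ge0_integration_by_substitutionNy.
- rewrite -[RHS]/(fine (Num.sqrt pi / 2)%:E) -integral0y_gauss.
  by congr fine; apply: eq_integral => x _ /=; rewrite /gauss_fun sqrrN.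
- exact/continuous_subspaceT/continuous_gauss_fun.
- by move=> x _; exact: gauss_fun_ge0.
Qed.

(** The known limit is that of the squared integral over [[0, x]], namely [pi / 4]. Its square root
    is added to [gauss_cdf 0]. *)
Lemma gauss_cdf_cvgy {R : realType} :
  gauss_cdf x @[x --> +oo] --> (Num.sqrt pi : R).
Proof.
have E (x : R) : 0 <= x ->
    gauss_cdf x = gauss_cdf 0 + gauss_integral_proof.integral0_gauss x.
  by move=> x0; rewrite -[gauss_integral_proof.integral0_gauss x]gauss_cdfB // addrC subrK.
have cvg_Ig : @gauss_integral_proof.integral0_gauss R x @[x --> +oo] --> Num.sqrt pi / 2.
  have : Num.sqrt (@gauss_integral_proof.integral0_gauss R x ^+ 2) @[x --> +oo]
      --> Num.sqrt (pi / 4).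
    apply: continuous_cvg; first exact: sqrt_continuous.
    exact: gauss_integral_proof.cvg_integral0_gauss_sqr.
  rewrite sqrtrM ?pi_ge0// sqrtrV// (_ : 4 = 2 ^+ 2); last by rewrite expr2 -natrM.
  rewrite sqrtr_sqr ger0_norm//.
  under eq_fun do
    rewrite sqrtr_sqr ger0_norm ?gauss_integral_proof.integral0_gauss_ge0//.
  by [].
have -> : Num.sqrt pi = gauss_cdf 0 + Num.sqrt pi / 2 :> R.
  by rewrite gauss_cdf0; lra.
have : gauss_cdf 0 + @gauss_integral_proof.integral0_gauss R x @[x --> +oo]
    --> (gauss_cdf 0 + Num.sqrt pi / 2 : R).
  by apply: cvgD => //; exact: cvg_cst.
apply: cvg_trans; apply: near_eq_cvg.
by near=> x; rewrite (E x).
Unshelve. all: by end_near. Qed.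

Lemma gauss_cdf_le {R : realType} (x : R) : gauss_cdf x <= Num.sqrt pi.
Proof.
rewrite -(cvg_lim _ gauss_cdf_cvgy) //; apply: limr_ge.
  by apply/cvg_ex; exists (Num.sqrt pi); exact: gauss_cdf_cvgy.
by near=> y; apply: gauss_cdf_nondecreasing; near: y; apply: nbhs_pinfty_ge; rewrite num_real.
Unshelve. all: by end_near. Qed.

(** Affine substitution in the normal density. The factor [Num.sqrt 2] appears because [gauss_fun]
    is [expR (- t ^+ 2)], without the usual 1/2 in the exponent. *)
Lemma normal_prob_cdf {R : realType} (m s x : R) : 0 < s ->
  normal_prob m s `]-oo, m + Num.sqrt 2 * s * x]
  = (gauss_cdf x / Num.sqrt pi)%:E.
Proof.
move=> s0; set k := Num.sqrt 2 * s.
have k0 : 0 < k by rewrite mulr_gt0 // sqrtr_gt0.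
pose F (y : R) : R := m + k * y.
have dF (y : R) : is_derive y 1 F k.
  by apply: is_derive_eq; rewrite /GRing.scale/=; ring.
have F'E : F^`()%classic = cst k.
  by apply/funext => y; rewrite derive1E derive_val.
rewrite /normal_prob -/(F x) increasing_ge0_integration_by_substitutionNy.
- have -> : (gauss_cdf x / Num.sqrt pi)%:E =
      ((Num.sqrt pi)^-1%:E * \int[lebesgue_measure]_(y in `]-oo, x]) (gauss_fun y)%:E)%E.
    rewrite /gauss_cdf /Rintegral mulrC EFinM fineK //.
    by apply: integrable_fin_num => //; exact: gauss_integrable.
  rewrite -integralZl//; last exact: gauss_integrable.
  apply: eq_integral => y _; rewrite F'E -EFinM; congr EFin.
  rewrite fctE /= normal_pdfE ?gt_eqF // /normal_peak /normal_fun /F.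
  rewrite mulrAC; congr (_ * _).
    have spi : 0 <= s ^+ 2 * pi by rewrite mulr_ge0 ?sqr_ge0 ?pi_ge0.
    rewrite /k -mulr_natr sqrtrM //.
    rewrite sqrtrM ?sqr_ge0 // sqrtr_sqr gtr0_norm //.
    by field; rewrite ?ltW // !gt_eqF // ?sqrtr_gt0 ?pi_gt0.
  have -> : - (m + k * y - m) ^+ 2 / (s ^+ 2 *+ 2) = - y ^+ 2.
    rewrite addrAC subrr add0r exprMn /k exprMn sqr_sqrtr // -mulr_natr.
    by field; rewrite gt_eqF.
  by [].
- by move=> y z _ _ yz; rewrite /F ltrD2l ltr_pM2l.
- by rewrite F'E => ? _; exact: cvg_cst.
- by rewrite F'E; exact: is_cvg_cst.
- by rewrite F'E; exact: cvg_cst.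
- split; first by move=> y _; have [] := dF y.
  apply: cvg_at_left_filter.
  apply: differentiable_continuous; apply/derivable1_diffP.
  by have [] := dF x.
- apply: (cvg_comp _ _ (gt0_cvgMrNy k0 cvg_id)); exact: cvg_addrl_Ny.
- apply/continuous_subspaceT/continuous_normal_pdf; by rewrite gt_eqF.
- by move=> y _; exact: normal_pdf_ge0.
Qed.

Lemma normal_prob_le {R : realType} (m s x y : R) : x <= y ->
  (normal_prob m s `]-oo, x] <= normal_prob m s `]-oo, y])%E.
Proof.
move=> xy; apply: le_measure; rewrite ?inE //=; exact: subset_itvl.
Qed.

Lemma erfE {R : realType} (x : R) : erf x = 2 * (gauss_cdf x / Num.sqrt pi) - 1.
Proof.
have p0 : Num.sqrt pi != 0 :> R by rewrite gt_eqF // sqrtr_gt0 pi_gt0.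
rewrite /erf; case: leP => x0.
  by rewrite -gauss_cdfB // gauss_cdf0; field.
by rewrite -gauss_cdfB ?ltW // gauss_cdf0; field.
Qed.

(** Since [erf_inv] is an [xget] with default 0, the content is the existence of a preimage,
    obtained from the intermediate value theorem. *)
Lemma erf_invK {R : realType} (y : R) : 0 <= y < 1 -> erf (erf_inv y) = y.
Proof.
move=> /andP[y0 y1]; suff : [set x | erf x = y] !=set0 by exact: xgetPex.
have p0 : 0 < Num.sqrt pi :> R by rewrite sqrtr_gt0 pi_gt0.
(* By [erfE], [erf c = y] amounts to [gauss_cdf c = z]. *)
pose z := (y + 1) / 2 * Num.sqrt pi.
have zpi : z < Num.sqrt pi by rewrite /z gtr_pMl //; lra.
have [N [N0 zN]] : exists N : R, 0 <= N /\ z <= gauss_cdf N.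
  have : \forall N \near +oo, 0 <= N /\ z <= gauss_cdf N :> R.
    near=> N; split; near: N.
      by apply: nbhs_pinfty_ge; rewrite num_real.
    exact: (cvgr_ge _ gauss_cdf_cvgy).
  by move=> /filter_ex[N]; exists N.
have [||c _ Ec] := @IVT R gauss_cdf 0 N z N0.
- exact/continuous_subspaceT/gauss_cdf_continuous.
- rewrite min_l ?max_r ?gauss_cdf_nondecreasing // zN gauss_cdf0 andbT.
  by rewrite /z mulrC ler_pM2r //; lra.
exists c; rewrite /= erfE Ec /z; field.
by rewrite gt_eqF.
Unshelve. all: by end_near. Qed.

(** The robot's bound: the left-hand side of the hypothesis is the [s]-quantile of the law. The
    bound [1 / 2 <= s] puts [2 * s - 1] in the range of [erf_invK]; for [v = 0] the law is a Dirac
    mass. *)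
Lemma gauss_law_ge {R : realType} (m v s b : R) : 0 <= v -> 1 / 2 <= s < 1 ->
  m + Num.sqrt (2 * v) * erf_inv (2 * s - 1) <= b ->
  (s%:E <= gauss_law m v `]-oo, b])%E.
Proof.
move=> v0 /andP[s2 s1]; rewrite /gauss_law; have [->|vn0] := eqVneq v 0.
  rewrite mulr0 sqrtr0 mul0r addr0 => mb.
  by rewrite diracE mem_set ?lee_fin ?ltW //= in_itv.
have v_gt0 : 0 < v by rewrite lt0r vn0.
move=> h; apply: le_trans (normal_prob_le _ _ _ _ h).
rewrite sqrtrM // normal_prob_cdf ?sqrtr_gt0 // lee_fin.
have : erf (erf_inv (2 * s - 1)) = 2 * s - 1 by apply: erf_invK; lra.
rewrite erfE; lra.
Qed.

(** * Chi-squared distributions with 2 and 3 degrees of freedom *)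

Lemma expRN_cvgy {R : realType} (k : R) : 0 < k ->
  expR (- (k * x)) @[x --> +oo] --> (0 : R).
Proof.
move=> k0; apply: (cvg_comp _ (fun x : R => expR (- x)) (gt0_cvgMry k0 cvg_id)).
exact: cvgr_expR.
Qed.

Lemma Gamma1 {R : realType} : Gamma 1 = 1 :> R.
Proof.
rewrite /Gamma subrr (@Rintegral_ge0_continuous_FTC2y R _ (fun x => - expR (- x)) 0 0).
- by rewrite oppr0 expR0 opprK add0r.
- by move=> x _; rewrite powRr0 mul1r expR_ge0.
- apply/continuous_subspaceT => x.
  under eq_fun do rewrite powRr0 mul1r.
  by apply: continuous_comp; [exact: continuousN|exact: continuous_expR].
- rewrite -[X in _ --> X]oppr0; apply: cvgN; exact: cvgr_expR.
- by move=> x _; exact: ex_derive.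
- apply: cvg_at_right_filter; apply: cvgN; apply: continuous_comp.
    exact: continuousN.
  exact: continuous_expR.
- by move=> x _; rewrite derive1E derive_val powRr0 mul1r /GRing.scale/=; ring.
Qed.

(* Antiderivative of [x `^ (1 / 2) * expR (- x)]: substitute x = y^2 and integrate by parts. *)
Definition Gamma32_prim {R : realType} (x : R) : R :=
  gauss_cdf (Num.sqrt x) - gauss_cdf 0 - Num.sqrt x * expR (- x).

(** The chain rule on [gauss_cdf (Num.sqrt x)] and the product rule on the last term both yield
    [expR (- x) / (2 * Num.sqrt x)], and these cancel. *)
Lemma Gamma32_prim_derive {R : realType} (x : R) : 0 < x ->
  is_derive x 1 Gamma32_prim (x `^ (1 / 2) * expR (- x)).
Proof.
move=> x0; have dsq := is_derive1_sqrt x0.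
have dJ := is_derive1_comp (gauss_cdf_is_derive (Num.sqrt x)) dsq.
have dE : is_derive x 1 (fun x : R => expR (- x)) (- expR (- x)).
  by apply: is_derive_eq; rewrite /GRing.scale/=; ring.
have dM := is_deriveM dsq dE.
have dJ0 := is_deriveB dJ (is_derive_cst (gauss_cdf 0) x 1).
have dP : is_derive x 1 Gamma32_prim _ := is_deriveB dJ0 dM.
apply: (is_derive_eq dP).
rewrite div1r powR12_sqrt ?ltW //.
rewrite /gauss_fun sqr_sqrtr ?ltW // /GRing.scale/=.
have sx : Num.sqrt x != 0 by rewrite gt_eqF // sqrtr_gt0.
by field.
Qed.

Lemma Gamma32_prim_continuous {R : realType} : continuous (@Gamma32_prim R).
Proof.
move=> x; apply: cvgB; first (apply: cvgB; last exact: cvg_cst).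
  apply: continuous_comp; first exact: sqrt_continuous.
  exact: gauss_cdf_continuous.
apply: cvgM; first exact: sqrt_continuous.
by apply: continuous_comp; [exact: continuousN|exact: continuous_expR].
Qed.

Lemma Gamma32_prim0 {R : realType} : Gamma32_prim 0 = 0 :> R.
Proof. by rewrite /Gamma32_prim sqrtr0 subrr mul0r subr0. Qed.

Lemma Gamma32_prim_cvgy {R : realType} :
  Gamma32_prim x @[x --> +oo] --> (Num.sqrt pi / 2 : R).
Proof.
have sqrty : Num.sqrt x @[x --> +oo] --> (+oo : set_system R).
  apply/cvgryPge => A; near=> x.
  apply: (@le_trans _ _ `|A|); first exact: ler_norm.
  rewrite -sqrtr_sqr ler_wsqrtr //.
have -> : Num.sqrt pi / 2 = Num.sqrt pi - gauss_cdf 0 - 0 :> R.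
  by rewrite gauss_cdf0; lra.
apply: cvgB; first (apply: cvgB; last exact: cvg_cst).
  exact: (cvg_comp _ _ sqrty gauss_cdf_cvgy).
(* The majorant comes from [Num.sqrt x <= 1 + x <= 4 * (1 + x / 2) <= 4 * expR (x / 2)]. *)
apply: (@squeeze_cvgr _ _ _ _ (cst 0) (fun x => 4 * expR (- (1 / 2 * x)))).
- near=> x; have x0 : 0 <= x.
    by near: x; apply: nbhs_pinfty_ge; rewrite num_real.
  rewrite mulr_ge0 ?sqrtr_ge0 ?expR_ge0 //=.
  have -> : - x = - (1 / 2 * x) + - (1 / 2 * x) by lra.
  rewrite expRD mulrA ler_pM2r ?expR_gt0 //.
  rewrite expRN ler_pdivrMr ?expR_gt0 //.
  have : 1 + 1 / 2 * x <= expR (1 / 2 * x) by apply: expR_ge1Dx; lra.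
  have : Num.sqrt x <= 1 + x.
    rewrite -[leRHS]ger0_norm ?addr_ge0 // -sqrtr_sqr ler_wsqrtr //; nra.
  lra.
- exact: cvg_cst.
- rewrite -[X in _ --> X](mulr0 4); apply: cvgM; first exact: cvg_cst.
  by apply: expRN_cvgy; lra.
Unshelve. all: by end_near. Qed.

Lemma powR_half_continuous {R : realType} :
  {within `[0, +oo[, continuous (fun x : R => x `^ (1 / 2))}.
Proof.
apply: (@subspace_eq_continuous _ _ _ Num.sqrt).
  by move=> x; rewrite inE /= in_itv /= andbT => x0; rewrite -powR12_sqrt // div1r.
exact/continuous_subspaceT/sqrt_continuous.
Qed.

Lemma Gamma32 {R : realType} : Gamma (3 / 2) = Num.sqrt pi / 2 :> R.
Proof.
rewrite /Gamma (_ : 3 / 2 - 1 = 1 / 2 :> R); last by lra.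
rewrite (@Rintegral_ge0_continuous_FTC2y R _ Gamma32_prim 0 (Num.sqrt pi / 2)).
- by rewrite Gamma32_prim0 subr0.
- by move=> x _; rewrite mulr_ge0 ?powR_ge0 ?expR_ge0.
- move=> x; apply: cvgM; first exact: powR_half_continuous.
  apply: continuous_subspaceT => y.
  by apply: continuous_comp; [exact: continuousN|exact: continuous_expR].
- exact: Gamma32_prim_cvgy.
- by move=> x x0; have [] := Gamma32_prim_derive _ x0.
- apply: cvg_at_right_filter; exact: Gamma32_prim_continuous.
- move=> x; rewrite in_itv /= andbT => x0.
  by rewrite derive1E; have [_] := Gamma32_prim_derive _ x0.
Qed.

(** Differentiability is asked only for [0 < x], which is what [Gamma32_prim_derive] provides;
    continuity of [F] covers the endpoint 0. *)
Lemma Rintegral_FTC2 {R : realType} (f F : R -> R) (b : R) : 0 <= b ->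
  {within `[0, b], continuous f} -> continuous F ->
  (forall x : R, 0 < x -> is_derive x 1 F (f x)) ->
  Rintegral lebesgue_measure `[0, b] f = F b - F 0.
Proof.
rewrite le_eqVlt => /predU1P[<- _ _ _|b0 cf cF dF].
  by rewrite set_itv1 Rintegral_set1 subrr.
rewrite /Rintegral (continuous_FTC2 b0 cf (F := F)) -?EFinB //.
- split.
  + by move=> x; rewrite in_itv /= => /andP[/dF[]].
  + by apply: cvg_at_right_filter; exact: cF.
  + by apply: cvg_at_left_filter; exact: cF.
- by move=> x; rewrite in_itv /= => /andP[x0 _]; rewrite derive1E; have [_] := dF _ x0.
Qed.

Lemma chi2_cdf2 {R : realType} (t : R) : 0 <= t ->
  chi2_cdf 2 t = 1 - expR (- (t / 2)).
Proof.
move=> t0; rewrite /chi2_cdf.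
have pdfE : chi2_pdf 2 = (fun x : R => expR (- (x / 2)) / 2).
  apply/funext => x; rewrite /chi2_pdf divff // subrr powRr0 powRr1 // Gamma1.
  by rewrite mulr1 mul1r mulNr.
have cE : continuous (fun x : R => expR (- (x / 2))).
  move=> x; apply: continuous_comp; last exact: continuous_expR.
  by apply: cvgN; apply: cvgM => //; exact: cvg_cst.
have dF (x : R) : 0 < x -> is_derive x 1 (fun x : R => - expR (- (x / 2))) (expR (- (x / 2)) / 2).
  by move=> _; apply: is_derive_eq; rewrite /GRing.scale/=; field.
rewrite pdfE (Rintegral_FTC2 _ _ _ t0 _ _ dF).
- by rewrite mul0r oppr0 expR0 opprK addrC.
- apply: continuous_subspaceT => x; apply: cvgM; [exact: cE|exact: cvg_cst].
- by move=> x; apply: cvgN; exact: cE.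
Qed.

(** With [x / 2] as variable, the density is a multiple of the integrand of [Gamma (3 / 2)], whose
    antiderivative is [Gamma32_prim]. *)
Lemma chi2_cdf3 {R : realType} (t : R) : 0 <= t ->
  chi2_cdf 3 t = 2 / Num.sqrt pi * Gamma32_prim (t / 2).
Proof.
move=> t0; rewrite /chi2_cdf.
have p0 : Num.sqrt pi != 0 :> R by rewrite gt_eqF // sqrtr_gt0 pi_gt0.
have h : 3 / 2 - 1 = 1 / 2 :> R by lra.
have half0 (x : R) : 0 <= x -> 0 <= x / 2 by move=> ?; lra.
have pdfE (x : R) : 0 <= x -> chi2_pdf 3 x =
    2 / Num.sqrt pi * ((x / 2) `^ (1 / 2) * expR (- (x / 2)) * 2^-1).
  move=> x0; rewrite /chi2_pdf Gamma32 h mulNr !div1r.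
  rewrite !powR12_sqrt ?half0 // sqrtrM // sqrtrV //.
  rewrite (_ : 2 `^ (3 / 2) = 2 * 2 `^ 2^-1); last first.
    rewrite (_ : 3 / 2 = 1 + 2^-1); last by lra.
    rewrite powRD ?powRr1 //; exact/implyP.
  rewrite powR12_sqrt //.
  have q : Num.sqrt 2 != 0 :> R by rewrite gt_eqF // sqrtr_gt0.
  by field; rewrite p0 q.
rewrite (_ : Rintegral _ _ _ = Rintegral lebesgue_measure `[0, t]
    (fun x : R => 2 / Num.sqrt pi * ((x / 2) `^ (1 / 2) * expR (- (x / 2)) * 2^-1))); last first.
  by apply: eq_Rintegral => x; rewrite inE /= in_itv /= => /andP[x0 _]; exact: pdfE.
have dF (x : R) : 0 < x -> is_derive x 1 (fun x : R => 2 / Num.sqrt pi * Gamma32_prim (x / 2))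
    (2 / Num.sqrt pi * ((x / 2) `^ (1 / 2) * expR (- (x / 2)) * 2^-1)).
  move=> x0; have x20 : 0 < x / 2 by lra.
  have d2 : is_derive x 1 (fun x : R => x / 2) (2^-1).
    by apply: is_derive_eq; rewrite /GRing.scale/=; ring.
  have dP := @is_derive1_comp R Gamma32_prim (fun x : R => x / 2) x _ _
    (Gamma32_prim_derive (x / 2) x20) d2.
  apply: is_derive_eq; rewrite /GRing.scale/=; ring.
rewrite (Rintegral_FTC2 _ _ _ t0 _ _ dF).
- by rewrite mul0r Gamma32_prim0 mulr0 subr0.
(* The integrand agrees on [[0, t]] with this version using [Num.sqrt], which is continuous
   everywhere. *)
- have cS : continuous (fun x : R => 2 / Num.sqrt pi *
      (Num.sqrt (x / 2) * expR (- (x / 2)) * 2^-1)).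
    move=> x; apply: cvgM; first exact: cvg_cst.
    apply: cvgM; last exact: cvg_cst.
    have cx : continuous (fun x : R => x / 2).
      by move=> y; apply: cvgM => //; exact: cvg_cst.
    apply: cvgM.
      by apply: continuous_comp; [exact: cx|exact: sqrt_continuous].
    apply: continuous_comp; last exact: continuous_expR.
    by apply: cvgN; exact: cx.
  apply: (subspace_eq_continuous _ (continuous_subspaceT cS)).
  move=> x; rewrite inE /= in_itv /= => /andP[x0 _].
  by rewrite /from_subspace div1r powR12_sqrt ?half0.
- move=> x; apply: cvgM; first exact: cvg_cst.
  apply: (@continuous_comp _ _ _ (fun x : R => x / 2) Gamma32_prim);
    last exact: Gamma32_prim_continuous.
  by apply: cvgM => //; exact: cvg_cst.
Qed.

Lemma gauss_cdf_tail {R : realType} (u : R) : 0 <= u ->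
  Num.sqrt pi - gauss_cdf u <= Num.sqrt pi / 2 * gauss_fun u.
Proof.
move=> u0.
(* [D v >= 0] says that [gauss_cdf v - gauss_cdf u] is at most [gauss_fun u] times
   the mass of [0, v - u], because [v^2 >= u^2 + (v - u)^2]. *)
pose D (v : R) : R := gauss_fun u * (gauss_cdf (v - u) - gauss_cdf 0) - (gauss_cdf v - gauss_cdf u).
have dD (v : R) : is_derive v 1 D (gauss_fun u * gauss_fun (v - u) - gauss_fun v).
  have d1 : is_derive v 1 (fun v : R => v - u) 1.
    by apply: is_derive_eq; rewrite subr0.
  have d2 := @is_derive1_comp R gauss_cdf (fun v : R => v - u) v _ _
    (gauss_cdf_is_derive (v - u)) d1.
  have d3 := gauss_cdf_is_derive v.
  apply: is_derive_eq; rewrite /GRing.scale/=; ring.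
have cD : continuous D.
  move=> v; apply: differentiable_continuous; apply/derivable1_diffP.
  by have [] := dD v.
have D_ge0 v : u <= v -> 0 <= D v.
  move=> uv; have Du : D u = 0 by rewrite /D !subrr mulr0 subr0.
  have dD' x : x \in `]u, v[ -> derivable D x 1 by move=> _; have [] := dD x.
  have D'_ge0 x : x \in `]u, v[ -> 0 <= D^`()%classic x.
    rewrite in_itv /= => /andP[ux _]; rewrite derive1E; have [_ ->] := dD x.
    rewrite subr_ge0 /gauss_fun -expRD ler_expR; nra.
  rewrite -Du; apply: (ger0_derive1_le_cc dD' D'_ge0) => //.
  - exact: continuous_subspaceT.
  - by rewrite in_itv /= lexx.
  - by rewrite in_itv /= lexx andbT.
(* Let [v] tend to infinity in [0 <= D v]; the mass of [[0, v - u]] never exceeds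
   [Num.sqrt pi / 2]. *)
rewrite lerBlDr -[X in X <= _](cvg_lim _ gauss_cdf_cvgy) //.
apply: limr_le; first by apply/cvg_ex; exists (Num.sqrt pi); exact: gauss_cdf_cvgy.
near=> v.
have uv : u <= v by near: v; apply: nbhs_pinfty_ge; rewrite num_real.
have := D_ge0 _ uv; rewrite /D.
have : gauss_fun u * (gauss_cdf (v - u) - gauss_cdf 0) <= Num.sqrt pi / 2 * gauss_fun u.
  rewrite mulrC ler_wpM2r ?gauss_fun_ge0 // gauss_cdf0.
  by have := gauss_cdf_le (v - u); lra.
lra.
Unshelve. all: by end_near. Qed.

(** As for [erf_inv], a witness is needed: explicit for 2 degrees of freedom, from the intermediate
    value theorem for 3. *)
Lemma chi2_invP {R : realType} (k : nat) (s : R) : (k = 2 \/ k = 3)%N -> 0 <= s < 1 ->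
  0 <= chi2_inv k s /\ chi2_cdf k (chi2_inv k s) = s.
Proof.
move=> k23 /andP[s0 s1].
suff : [set t | 0 <= t /\ chi2_cdf k t = s] !=set0 by exact: xgetPex.
case: k23 => ->.
  have h0 : 0 < 1 - s by lra.
  have t0 : 0 <= - (2 * ln (1 - s)).
    have : ln (1 - s) <= 0 by apply: ln_le0; lra.
    lra.
  exists (- (2 * ln (1 - s))); split=> //=.
  rewrite chi2_cdf2 // (_ : - (_ / 2) = ln (1 - s)); last by field.
  by rewrite lnK ?posrE //; ring.
have p0 : 0 < Num.sqrt pi :> R by rewrite sqrtr_gt0 pi_gt0.
pose z := s * (Num.sqrt pi / 2).
have zpi : z < Num.sqrt pi / 2 by rewrite /z gtr_pMl //; lra.
have [N [N0 zN]] : exists N : R, 0 <= N /\ z <= Gamma32_prim N.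
  have : \forall N \near +oo, 0 <= N /\ z <= Gamma32_prim N :> R.
    near=> N; split; near: N.
      by apply: nbhs_pinfty_ge; rewrite num_real.
    exact: (cvgr_ge _ Gamma32_prim_cvgy).
  by move=> /filter_ex[N]; exists N.
have z0 : 0 <= z by rewrite /z mulr_ge0 // divr_ge0 // ltW.
have [||c c0 Ec] := @IVT R Gamma32_prim 0 N z N0.
- exact/continuous_subspaceT/Gamma32_prim_continuous.
- rewrite Gamma32_prim0 min_l ?max_r ?(le_trans z0 zN) //.
  by rewrite z0.
move: c0; rewrite in_itv /= => /andP[c0 _].
(* The factor 2 undoes the halving of the argument in [chi2_cdf3]. *)
exists (2 * c); split=> /=; first by lra.
rewrite chi2_cdf3; last by lra.
rewrite (_ : 2 * c / 2 = c); last by field.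
by rewrite Ec /z; field; rewrite gt_eqF.
Unshelve. all: by end_near. Qed.

(** With t the chi-squared quantile, the right-hand side is the standard normal distribution
    function at [Num.sqrt t]; the division by 2 compensates for the scaling of [gauss_fun]. *)
Lemma chi2_inv_le_gauss {R : realType} (k : nat) (s : R) : (k = 2 \/ k = 3)%N ->
  0 <= s < 1 -> s <= gauss_cdf (Num.sqrt (chi2_inv k s / 2)) / Num.sqrt pi.
Proof.
move=> k23 s01; have [t0] := chi2_invP k _ k23 s01.
move: (chi2_inv k s) t0 => t t0 Et.
have t20 : 0 <= t / 2 by lra.
have p0 : 0 < Num.sqrt pi :> R by rewrite sqrtr_gt0 pi_gt0.
rewrite ler_pdivlMr //.
set u := Num.sqrt (t / 2); have u0 : 0 <= u by rewrite sqrtr_ge0.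
case: k23 Et => ->.
  (* The tail bound gives [1 - e / 2] below the normal value, with [e = expR (- (t / 2))], whereas
     only [1 - e] is required. *)
  rewrite chi2_cdf2 // => <-.
  have := gauss_cdf_tail u u0; rewrite /gauss_fun sqr_sqrtr //.
  set e := expR _ => h; have e0 : 0 <= Num.sqrt pi * e by rewrite mulr_ge0 ?expR_ge0 ?ltW.
  lra.
rewrite chi2_cdf3 // /Gamma32_prim -/u => <-.
have -> : 2 / Num.sqrt pi * (gauss_cdf u - gauss_cdf 0 - u * expR (- (t / 2))) * Num.sqrt pi
    = 2 * (gauss_cdf u - gauss_cdf 0 - u * expR (- (t / 2))).
  by field; rewrite gt_eqF.
(* Dropping this term leaves [2 * gauss_cdf u - Num.sqrt pi], at most [gauss_cdf u] because
   [gauss_cdf u <= Num.sqrt pi]. *)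
have : 0 <= u * expR (- (t / 2)) by rewrite mulr_ge0 ?expR_ge0.
have := gauss_cdf_le u; rewrite gauss_cdf0. lra.
Qed.

(** * Independence and measurability of events *)

(** The finite measures [P (E]&[B)] and [P E * P B] in [E] agree on a pi-system containing the whole
    space, hence on the sigma-algebra it generates. *)
Lemma measure_indep_sigma {R : realType} (dT : measure_display) (T : measurableType dT)
    (P : probability T R) (G : set (set T)) (B : set T) :
  setI_closed G -> G setT -> G `<=` measurable -> measurable B ->
  (forall E, G E -> P (E `&` B) = (P E * P B)%E) ->
  forall E, <<s G >> E -> P (E `&` B) = (P E * P B)%E.
Proof.
move=> GI GT Gm mB GB E sE.
have fB : P B \is a fin_num by exact: fin_num_measure.
have PB0 : (0 <= fine (P B))%R by exact: fine_ge0.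
have scaleE A : mscale (NngNum PB0) P A = (P A * P B)%E.
  by rewrite /mscale /= fineK // muleC.
rewrite -scaleE -/(mrestr P mB E).
apply: (g_sigma_algebra_measure_unique G Gm (fun=> setT)) => //.
- by rewrite bigcup_const.
- by move=> A GA; rewrite [RHS]scaleE -GB.
- move=> k; apply: le_lt_trans (probability_le1 P _) _; last exact: ltry.
  exact: measurableI.
Qed.

Lemma measurable_dotv {R : realType} (d : measure_display) (U : measurableType d) {n}
    (a : 'cV[R]_n) (X : U -> 'cV[R]_n) :
  (forall j, measurable_fun setT (fun w => X w j 0)) ->
  measurable_fun setT (fun w => dotv a (X w)).
Proof.
move=> mX; rewrite (_ : (fun w => _) = (fun w => \sum_j a j 0 * X w j 0)).
  by apply: measurable_sum => j; apply: measurable_funM => //; exact: measurable_cst.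
apply/funext => w; rewrite /dotv mxE; apply: eq_bigr => j _; by rewrite mxE.
Qed.

(** The pi-system on which [indep_vec] states its product rule. *)
Definition box_events {R : realType} {T : Type} {n} (X : T -> 'cV[R]_n) : set (set T) :=
  [set E | exists A : 'I_n -> set R, (forall j, measurable (A j)) /\
    E = [set w | forall j, A j (X w j 0)]].

Lemma box_events_setI {R : realType} {T : Type} {n} (X : T -> 'cV[R]_n) :
  setI_closed (box_events X).
Proof.
move=> _ _ [A [mA ->]] [B [mB ->]]; exists (fun j => A j `&` B j); split.
  by move=> j; exact: measurableI.
apply/seteqP; split => w /=; first by move=> [hA hB] j; split.
by move=> h; split => j; have [] := h j.
Qed.

Lemma box_eventsT {R : realType} {T : Type} {n} (X : T -> 'cV[R]_n) :
  box_events X setT.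
Proof. by exists (fun=> setT); split=> //; apply/seteqP; split. Qed.

Lemma box_events_measurable {R : realType} (dT : measure_display) (T : measurableType dT)
    {n} (X : T -> 'cV[R]_n) :
  (forall j, measurable_fun setT (fun w => X w j 0)) ->
  box_events X `<=` measurable.
Proof.
move=> mX _ [A [mA ->]].
rewrite (_ : [set w | _] = \bigcap_(j in setT) ((fun w => X w j 0) @^-1` A j)).
  apply: fin_bigcap_measurable => // j _.
  by rewrite -[X in measurable X]setTI; exact: mX.
by apply/seteqP; split => w /= h j; [move=> _; exact: h|exact: h].
Qed.

(** Equip [T] with the sigma-algebra generated by the boxes: the coordinates become measurable, and
    so does every linear form in them. *)
Lemma box_events_dotv {R : realType} (dT : measure_display) (T : measurableType dT)
    {n} (X : T -> 'cV[R]_n) (a : 'cV[R]_n) (A : set R) : measurable A ->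
  <<s box_events X >> ((fun w => dotv a (X w)) @^-1` A).
Proof.
move=> mA.
have mX j : measurable_fun setT
    (fun w : g_sigma_algebraType (box_events X) => X w j 0).
  move=> _ B mB; rewrite setTI; apply: sub_sigma_algebra.
  (* An event on coordinate [j] is a box whose other sides are the whole line. *)
  exists (fun k => if k == j then B else setT); split.
    by move=> k; case: ifP.
  apply/seteqP; split => w /=; last by move=> /(_ j); rewrite eqxx.
  by move=> h k; case: ifP => // /eqP ->.
by have := measurable_dotv _ _ a _ mX measurableT A mA; rewrite setTI.
Qed.

(** Independence passes from boxes to half-space events one vector at a time. *)
Lemma indep_vec_dotv {R : realType} (dT : measure_display) (T : measurableType dT)
    (P : probability T R) {n} (X Y : T -> 'cV[R]_n) (a b : 'cV[R]_n) (A B : set R) :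
  (forall j, measurable_fun setT (fun w => X w j 0)) ->
  (forall j, measurable_fun setT (fun w => Y w j 0)) ->
  indep_vec P X Y -> measurable A -> measurable B ->
  let EX := (fun w => dotv a (X w)) @^-1` A in
  let EY := (fun w => dotv b (Y w)) @^-1` B in
  P (EX `&` EY) = (P EX * P EY)%E.
Proof.
move=> mX mY iXY mA mB EX EY.
have sX : <<s box_events X >> EX by exact: box_events_dotv.
have sY : <<s box_events Y >> EY by exact: box_events_dotv.
have mEX : measurable EX.
  by rewrite -[EX]setTI; apply: measurable_dotv.
(* First reduce the event of [Y] to a box with [EX] fixed, then the event of [X] to a box with that
   box fixed. *)
rewrite setIC muleC; apply: (measure_indep_sigma _ _ P (box_events Y)) => //.
- exact: box_events_setI.
- exact: box_eventsT.
- exact: box_events_measurable.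
move=> F GF; rewrite setIC muleC.
apply: (measure_indep_sigma _ _ P (box_events X)) => //.
- exact: box_events_setI.
- exact: box_eventsT.
- exact: box_events_measurable.
- exact: box_events_measurable GF.
move: GF => [C [mC ->]] _ [D [mD ->]]; exact: iXY.
Qed.

(** An open set is the union of the countably many rational boxes it contains, and the preimage of a
    box is a finite intersection of coordinate events. *)
Lemma measurable_preimage_open_box {R : realType} (dT : measure_display)
    (T : measurableType dT) {n} (Z : T -> 'cV[R]_n) (U : set 'cV[R]_n) :
  (forall j, measurable_fun setT (fun w => Z w j 0)) ->
  (forall z, U z -> exists2 e : R, 0 < e &
    forall y : 'cV[R]_n, (forall j, `|y j 0 - z j 0| < e) -> U y) ->
  measurable (Z @^-1` U).
Proof.
move=> mZ oU.
pose box (i : 'cV[rat]_n * rat) : set 'cV[R]_n :=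
  [set y | forall j, `|y j 0 - ratr (i.1 j 0)| < ratr i.2].
pose F i : set T := if `[< box i `<=` U >] then Z @^-1` box i else set0.
have -> : Z @^-1` U = \bigcup_i F i.
  apply/seteqP; split => w /=; last first.
    by move=> [i _]; rewrite /F; case: ifPn => // /asboolP + ?; apply.
  (* Take a radius below [e / 2] and a rational centre within that radius of [Z w]: the box contains
     [Z w] and stays within [e] of it. *)
  move=> /oU[e e0 He].
  have [r] : exists r : rat, ratr r \in `]0, e / 2[.
    by have /rat_in_itvoo[r] : 0 < e / 2 by [lra]; exists r.
  rewrite in_itv /= => /andP[r0 re].
  have /choice[q Hq] : forall j : 'I_n, exists q : rat,
      ratr q \in `]Z w j 0 - ratr r, Z w j 0 + ratr r[.
    move=> j.
    have /rat_in_itvoo[q] : Z w j 0 - ratr r < Z w j 0 + ratr r by [lra].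
    by exists q.
  have Zbox : forall j, `|Z w j 0 - ratr (q j)| < ratr r.
    move=> j; have := Hq j; rewrite in_itv /= => /andP[h1 h2].
    by rewrite ltr_norml; apply/andP; split; lra.
  exists (\col_j q j, r) => //; rewrite /F.
  rewrite ifT; first by move=> j /=; rewrite mxE; exact: Zbox.
  apply/asboolP => y hy; apply: He => j.
  have := hy j; have := Zbox j; rewrite /= mxE !ltr_norml.
  by move=> /andP[? ?] /andP[? ?]; apply/andP; split; lra.
apply: countable_bigcupT_measurable => [|i]; first exact: countableP.
rewrite /F; case: ifP => // _.
rewrite (_ : _ @^-1` _ = \bigcap_(j in setT)
   ((fun w => Z w j 0) @^-1` `]ratr (i.1 j 0) - ratr i.2, ratr (i.1 j 0) + ratr i.2[)).
  apply: fin_bigcap_measurable => // j _.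
  by rewrite -[X in measurable X]setTI; apply: mZ.
apply/seteqP; split => w /= h j.
  by move=> _ /=; rewrite in_itv /=; have := h j; rewrite ltr_distl.
by have := h j I; rewrite /= in_itv /= ltr_distl.
Qed.

(** * Euclidean geometry *)

Lemma dotvE {R : realType} {n} (u v : 'cV[R]_n) : dotv u v = \sum_j u j 0 * v j 0.
Proof. by rewrite /dotv mxE; apply: eq_bigr => j _; rewrite mxE. Qed.

Lemma dotvC {R : realType} {n} (u v : 'cV[R]_n) : dotv u v = dotv v u.
Proof. by rewrite !dotvE; apply: eq_bigr => j _; rewrite mulrC. Qed.

Lemma dotvDr {R : realType} {n} (u v w : 'cV[R]_n) : dotv u (v + w) = dotv u v + dotv u w.
Proof. by rewrite /dotv mulmxDr mxE. Qed.

Lemma dotvZr {R : realType} {n} (u v : 'cV[R]_n) (k : R) : dotv u (k *: v) = k * dotv u v.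
Proof. by rewrite /dotv -scalemxAr mxE. Qed.

Lemma dotvNr {R : realType} {n} (u v : 'cV[R]_n) : dotv u (- v) = - dotv u v.
Proof. by rewrite /dotv mulmxN mxE. Qed.

Lemma dotvNl {R : realType} {n} (u v : 'cV[R]_n) : dotv (- u) v = - dotv u v.
Proof. by rewrite dotvC dotvNr dotvC. Qed.

Lemma dotvZl {R : realType} {n} (u v : 'cV[R]_n) (k : R) : dotv (k *: u) v = k * dotv u v.
Proof. by rewrite dotvC dotvZr dotvC. Qed.

Lemma dotv_trmx {R : realType} {n} (M : 'M[R]_n) (u v : 'cV[R]_n) :
  dotv (M^T *m u) v = dotv u (M *m v).
Proof. by rewrite /dotv trmx_mul trmxK mulmxA. Qed.

Lemma dotvv_ge0 {R : realType} {n} (u : 'cV[R]_n) : 0 <= dotv u u.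
Proof. by rewrite dotvE sumr_ge0 // => j _; rewrite -expr2 sqr_ge0. Qed.

Lemma dotvv_eq0 {R : realType} {n} (u : 'cV[R]_n) : (dotv u u == 0) = (u == 0).
Proof.
apply/eqP/eqP => [|->]; last first.
  by rewrite dotvE big1 // => j _; rewrite !mxE mul0r.
rewrite dotvE => /eqP; rewrite psumr_eq0; last first.
  by move=> j _; rewrite -expr2 sqr_ge0.
move=> /allP h; apply/colP => j; rewrite mxE.
have /h : j \in index_enum 'I_n by rewrite mem_index_enum.
by rewrite /= -expr2 sqrf_eq0 => /eqP.
Qed.

Lemma vnorm_ge0 {R : realType} {n} (u : 'cV[R]_n) : 0 <= vnorm u.
Proof. exact: sqrtr_ge0. Qed.

Lemma sqr_vnorm {R : realType} {n} (u : 'cV[R]_n) : vnorm u ^+ 2 = dotv u u.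
Proof. by rewrite sqr_sqrtr ?dotvv_ge0. Qed.

Lemma vnorm_gt0 {R : realType} {n} (u : 'cV[R]_n) : u != 0 -> 0 < vnorm u.
Proof. by move=> u0; rewrite sqrtr_gt0 lt0r dotvv_eq0 u0 dotvv_ge0. Qed.

Lemma vnormN {R : realType} {n} (u : 'cV[R]_n) : vnorm (- u) = vnorm u.
Proof. by rewrite /vnorm dotvNl dotvNr opprK. Qed.

(** Cauchy-Schwarz, by expanding the squared norm of [dotv v v *: u - dotv u v *: v] and cancelling
    one factor [dotv v v]. *)
Lemma dotv_le_vnorm {R : realType} {n} (u v : 'cV[R]_n) :
  dotv u v <= vnorm u * vnorm v.
Proof.
have [->|v0] := eqVneq v 0.
  have -> : (0 : 'cV[R]_n) = 0 *: 0 by rewrite scale0r.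
  by rewrite dotvZr mul0r mulr_ge0 ?vnorm_ge0.
have C0 := vnorm_gt0 _ v0.
have h := dotvv_ge0 (dotv v v *: u - dotv u v *: v).
apply: (le_trans (ler_norm _)); rewrite -ler_sqr ?nnegrE ?mulr_ge0 ?vnorm_ge0 //.
rewrite real_normK ?num_real // exprMn !sqr_vnorm.
have D0 : 0 < dotv v v by rewrite -sqr_vnorm exprn_gt0.
rewrite -(ler_pM2l D0) -subr_ge0; apply: le_trans h _.
rewrite dotvDr dotvNr !dotvZr !(dotvC _ u) !(dotvC _ v) !dotvDr !dotvNr !dotvZr (dotvC v u).
by rewrite le_eqVlt; apply/orP; left; apply/eqP; ring.
Qed.

Lemma vnormD {R : realType} {n} (u v : 'cV[R]_n) : vnorm (u + v) <= vnorm u + vnorm v.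
Proof.
rewrite -ler_sqr ?nnegrE ?addr_ge0 ?vnorm_ge0 // sqrrD !sqr_vnorm.
rewrite dotvDr (dotvC _ u) (dotvC _ v) !dotvDr (dotvC v u).
have := dotv_le_vnorm u v; lra.
Qed.

(** The divisor [n.+1] avoids division by zero and makes the bound strict: n r^2 < (n+1)^2 r^2. *)
Lemma vnorm_lt_box {R : realType} {n} (u : 'cV[R]_n) (e : R) : 0 < e ->
  (forall j, `|u j 0| < e / n.+1%:R) -> vnorm u < e.
Proof.
move=> e0; have n0 : 0 < n.+1%:R :> R by rewrite ltr0n.
set r := e / _ => h; have r0 : 0 < r by rewrite divr_gt0.
have er : e = r * n.+1%:R by rewrite divfK // gt_eqF.
clearbody r.
rewrite -ltr_sqr ?nnegrE ?vnorm_ge0 ?ltW // sqr_vnorm dotvE.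
apply: (@le_lt_trans _ _ (\sum_(j < n) r ^+ 2)).
  apply: ler_sum => j _; rewrite -expr2 -real_normK ?num_real // ler_sqr ?nnegrE //.
    exact: ltW.
  exact: ltW.
rewrite sumr_const card_ord -mulr_natl [in ltRHS]er exprMn.
rewrite mulrC ltr_pM2l ?exprn_gt0 //.
have : 0 <= n%:R :> R by rewrite ler0n.
by rewrite -natr1; nra.
Qed.

(** Nonemptiness matters: the infimum of the empty set is 0 by default. *)
Lemma dis_geP {R : realType} {n} (r : R) (p : 'cV[R]_n) (O : set 'cV[R]_n) :
  O !=set0 -> (r <= dis p O) <-> (forall q, O q -> r <= vnorm (p - q)).
Proof.
move=> [q0 Oq0]; split=> [h q Oq|h].
  apply: le_trans h _; apply: ge_inf; last by exists q.
  by exists 0 => _ [x _ <-]; exact: vnorm_ge0.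
apply: lb_le_inf; first by exists (vnorm (p - q0)), q0.
by move=> _ [q Oq <-]; exact: h.
Qed.

(** The complement says that [p w - d w] lies in the open [r]-neighbourhood of [O], so a single
    random vector and an open set suffice. *)
Lemma measurable_dis_translate {R : realType} (dT : measure_display)
    (T : measurableType dT) {n} (r : R) (p d : T -> 'cV[R]_n) (O : set 'cV[R]_n) :
  O !=set0 ->
  (forall j, measurable_fun setT (fun w => p w j 0)) ->
  (forall j, measurable_fun setT (fun w => d w j 0)) ->
  measurable [set w | r <= dis (p w) (translate O (d w))].
Proof.
move=> O0 mp md.
pose U : set 'cV[R]_n := [set z | exists2 x, O x & vnorm (z - x) < r].
have -> : [set w | r <= dis (p w) (translate O (d w))] =
    ~` ((fun w => p w - d w) @^-1` U).
  have tO0 w : translate O (d w) !=set0 by case: O0 => x Ox; exists (x + d w), x.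
  have E w x : p w - (x + d w) = p w - d w - x by rewrite opprD addrCA addrC.
  apply/seteqP; split => w /=.
    move=> /(dis_geP _ _ _ (tO0 w)) h [x Ox]; rewrite -E ltNge => /negP; apply.
    by apply: h; exists x.
  move=> h; apply/(dis_geP _ _ _ (tO0 w)) => _ [x Ox <-].
  by rewrite leNgt; apply/negP => hx; apply: h; exists x => //; rewrite -E.
apply: measurableC; apply: measurable_preimage_open_box.
  move=> j; rewrite (_ : (fun w => _) = (fun w => p w j 0 - d w j 0)).
    exact: measurable_funB.
  by apply/funext => w; rewrite !mxE.
(* The slack in [vnorm (z - x) < r], scaled for [vnorm_lt_box]. *)
move=> z [x Ox zx]; exists ((r - vnorm (z - x)) / n.+1%:R).
  by rewrite divr_gt0 ?subr_gt0.
move=> y hy; exists x => //.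
have -> : y - x = (z - x) + (y - z) by rewrite [RHS]addrC addrA subrK.
apply: le_lt_trans (vnormD _ _) _; rewrite -ltrBrDl.
apply: vnorm_lt_box; first by rewrite subr_gt0.
by move=> j; rewrite !mxE; exact: hy.
Qed.

(** * Separating hyperplanes and the collision probability *)

Lemma conv_hull_nonempty {R : realType} {n} (V : seq 'cV[R]_n) : V != [::] ->
  conv_hull V !=set0.
Proof.
case: V => // v V _; exists v; exists (fun k => (k == ord0)%:R); split.
  by move=> k; rewrite ler0n.
split; first by rewrite (bigD1 ord0) //= big1 ?addr0 // => k /negPf ->.
rewrite (bigD1 ord0) //= scale1r big1 ?addr0 // => k /negPf ->.
by rewrite scale0r.
Qed.

(** A nonzero vector in the kernel of [S] would make the quadratic form vanish. *)
Lemma pdmx_unit {R : realType} {n} (S : 'M[R]_n) : pdmx S -> S \in unitmx.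
Proof.
move=> pdS; rewrite unitmxE unitfE; apply/negP => /det0P[v v0 vS].
have vT0 : v^T != 0 by apply: contra v0 => /eqP vT; rewrite -[v]trmxK vT trmx0.
have := pdS _ vT0.
by rewrite /dotv trmxK mulmxA vS mul0mx mxE ltxx.
Qed.

(** The obstacle's bound, with the threshold measured in standard deviations. *)
Lemma gauss_law0_ge_chi2 {R : realType} (k : nat) (v s : R) : (k = 2 \/ k = 3)%N ->
  0 <= s < 1 -> 0 < v ->
  (s%:E <= gauss_law 0 v `]-oo, (Num.sqrt (chi2_inv k s) * Num.sqrt v)%R])%E.
Proof.
move=> k23 s01 v0; rewrite /gauss_law gt_eqF //.
have [t0 _] := chi2_invP k s k23 s01.
have q : Num.sqrt 2 != 0 :> R by rewrite gt_eqF // sqrtr_gt0.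
rewrite (_ : _ * _ = 0 + Num.sqrt 2 * Num.sqrt v * Num.sqrt (chi2_inv k s / 2)).
  by rewrite normal_prob_cdf ?sqrtr_gt0 // lee_fin; exact: chi2_inv_le_gauss.
by rewrite sqrtrM // sqrtrV //; field.
Qed.

Lemma separated_dis_ge {R : realType} {n} (a p : 'cV[R]_n) (b r : R) (O : set 'cV[R]_n) :
  O !=set0 -> a != 0 -> dotv a p <= b - r * vnorm a ->
  (forall q, O q -> b <= dotv a q) -> r <= dis p O.
Proof.
move=> O0 a0 ap aO; apply/(dis_geP _ _ _ O0) => q /aO aq.
have := dotv_le_vnorm a (q - p); rewrite dotvDr dotvNr -(vnormN (q - p)) opprB => h.
rewrite -(ler_pM2r (vnorm_gt0 _ a0)) (mulrC (vnorm (p - q))); lra.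
Qed.

(** Test the inclusion at the point of the ball around [x] that is lowest along [a]; the radius is
    [Num.sqrt c] because [minkowski_ball] bounds the squared norm. *)
Lemma minkowski_ball_dotv {R : realType} {n} (a x : 'cV[R]_n) (A : set 'cV[R]_n) (b c : R) :
  0 <= c -> a != 0 -> minkowski_ball A c `<=` [set y | b <= dotv a y] ->
  A x -> b + Num.sqrt c * vnorm a <= dotv a x.
Proof.
move=> c0 a0 AB Ax; have na := vnorm_gt0 _ a0.
have na0 : vnorm a != 0 by rewrite gt_eqF.
have : b <= dotv a (x + - (Num.sqrt c / vnorm a) *: a).
  apply: AB; exists x, (- (Num.sqrt c / vnorm a) *: a); split=> //; split=> //.
  rewrite dotvZl dotvZr -sqr_vnorm.
  have -> : - (Num.sqrt c / vnorm a) * (- (Num.sqrt c / vnorm a) * vnorm a ^+ 2)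
      = Num.sqrt c ^+ 2 by field.
  by rewrite sqr_sqrtr.
rewrite dotvDr dotvZr -sqr_vnorm.
have -> : - (Num.sqrt c / vnorm a) * vnorm a ^+ 2 = - (Num.sqrt c * vnorm a) by field.
lra.
Qed.

Theorem theorem3 (R : realType) (n : nat) (rs delta : R)
  (dT : measure_display) (T : measurableType dT) (P : probability T R)
  (phat : 'cV[R]_n) (Si So : 'M[R]_n) (p dobs : T -> 'cV[R]_n)
  (Ohat : seq 'cV[R]_n) (sqSo W : 'M[R]_n) (psi : seq 'cV[R]_n)
  (a0 : 'cV[R]_n) (b0 : R) (aio : 'cV[R]_n) (bio : R)
  (others : seq ('cV[R]_n * R)) :
  (n = 2 \/ n = 3)%N -> 0 < rs -> 0 < delta < 3 / 4 ->
  Ohat != [::] ->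
  symmx Si -> psdmx Si -> symmx So -> pdmx So ->
  gauss_vec P p phat Si -> gauss_vec P dobs 0 So -> indep_vec P p dobs ->
  symmx sqSo -> pdmx sqSo -> sqSo *m sqSo = So -> W = invmx sqSo ->
  let eps := 1 - Num.sqrt (1 - delta) in
  let pW := W *m phat in
  let OW := [set W *m x | x in conv_hull Ohat] in
  let SW := conv_hull psi in
  minkowski_ball OW (chi2_inv n (1 - eps)) `<=` SW -> ~ SW pW ->
  qp_feasible pW psi a0 b0 ->
  (forall a b, qp_feasible pW psi a b -> dotv a0 a0 <= dotv a a) ->
  SW `<=` [set y | bio <= dotv a0 y] -> (exists y, SW y /\ dotv a0 y = bio) ->
  aio = W^T *m a0 ->
  B_UAVC rs delta Si ((aio, bio) :: others) phat ->
  ((1 - delta)%:E <= P [set w | (rs <= dis (p w) (translate (conv_hull Ohat) (dobs w)))%R])%E.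
Proof.
move=> n23 rs0 /andP[d0 d34] Ohat0 _ psdSi _ pdSo gp gd ipd symS pdS SS -> eps pW OW SW.
set s := Num.sqrt (1 - delta).
have -> : 1 - eps = s by rewrite /eps subKr.
move=> ballSW _ [apW apsi] _ SWb [y0 [SWy0 _]] Eaio inV.
(* This is where [delta < 3 / 4] enters. *)
have s_ge : 1 / 2 <= s.
  have -> : 1 / 2 = Num.sqrt ((1 / 2) ^+ 2) :> R by rewrite sqrtr_sqr ger0_norm //; lra.
  by apply: ler_wsqrtr; lra.
have s_lt1 : s < 1 by rewrite -sqrtr1 ltr_sqrt //; lra.
have s01 : 0 <= s < 1 by apply/andP; split; lra.
have ss : s ^+ 2 = 1 - delta by rewrite sqr_sqrtr //; lra.
have [c0 _] := chi2_invP n s n23 s01.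
set c := chi2_inv n s in c0 ballSW.
have Su := pdmx_unit _ pdS.
have WT : (invmx sqSo)^T = invmx sqSo by rewrite trmx_inv symS.
(* The touching point [y0] lies in the hull, and an empty family of weights cannot sum to 1. *)
have psi0 : psi != [::].
  apply/eqP => E; move: SWy0; rewrite /SW E => -[w [_ []]].
  by rewrite big_ord0 => /esym/eqP; rewrite oner_eq0.
(* For [a0 = 0] the constraints would force both [1 <= b0] and [b0 <= -1]. *)
have a0n0 : a0 != 0.
  apply/eqP => E.
  have [k kpsi] : exists k, k \in psi.
    by case: psi psi0 {apsi ballSW SWb SWy0 SW} => // k l _; exists k; rewrite mem_head.
  have := apsi _ kpsi; move: apW; rewrite E !(dotvC 0) -(scale0r (0 : 'cV[R]_n)) !dotvZr.
  lra.
have aion0 : aio != 0.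
  apply: contra a0n0 => /eqP Z; move: Eaio; rewrite Z WT => /(congr1 (mulmx sqSo)).
  by rewrite mulmx0 mulmxA mulmxV // mul1mx => <-.
(* Whitening: W So W^T is the identity. *)
have varo : dotv (- aio) (So *m - aio) = dotv a0 a0.
  rewrite mulmxN dotvNl dotvNr opprK Eaio dotv_trmx -SS WT.
  by rewrite -(mulmxA sqSo sqSo) mulKVmx // mulKmx.
have [mp Pp] := gp; have [md Pd] := gd.
pose A : set R := `]-oo, bio - rs * vnorm aio]%classic.
pose B : set R := `]-oo, Num.sqrt c * vnorm a0]%classic.
pose E1 := (fun w => dotv aio (p w)) @^-1` A.
(* The sign turns a lower bound on [dotv aio (dobs w)] into a lower half-line event. *)
pose E2 := (fun w => dotv (- aio) (dobs w)) @^-1` B.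
have PE1 : (s%:E <= P E1)%E.
  rewrite Pp; last exact: measurable_itv.
  apply: gauss_law_ge; [exact: psdSi|by apply/andP|].
  have := inV (aio, bio) (mem_head _ _); rewrite /= -/s; lra.
have PE2 : (s%:E <= P E2)%E.
  rewrite Pd; last exact: measurable_itv.
  rewrite varo (_ : dotv (- aio) 0 = 0); last first.
    by rewrite -(scale0r (0 : 'cV[R]_n)) dotvZr mul0r.
  by apply: gauss_law0_ge_chi2 => //; rewrite -sqr_vnorm exprn_gt0 // vnorm_gt0.
have mE1 : measurable E1.
  by rewrite -[E1]setTI; apply: measurable_dotv => //; exact: measurable_itv.
have mE2 : measurable E2.
  by rewrite -[E2]setTI; apply: measurable_dotv => //; exact: measurable_itv.
have O0 := conv_hull_nonempty _ Ohat0.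
apply: (@le_trans _ _ (P (E1 `&` E2))).
  rewrite indep_vec_dotv //; [|exact: measurable_itv|exact: measurable_itv].
  rewrite -ss expr2 EFinM; apply: lee_pmul => //; rewrite lee_fin; lra.
apply: le_measure; rewrite ?inE; [exact: measurableI|exact: measurable_dis_translate|].
move=> w []; rewrite /E1 /E2 /A /B /= !in_itv /= => hp hd.
apply: (@separated_dis_ge _ _ aio _ bio) => //.
  by case: O0 => x Ox; exists (x + dobs w), x.
move=> _ [x Ox <-].
(* The whitened point [W *m x] clears the hyperplane by [Num.sqrt c * vnorm a0], which on [E2]
   absorbs the displacement [dobs w]. *)
have := @minkowski_ball_dotv _ _ a0 (invmx sqSo *m x) OW bio c c0 a0n0
  (subset_trans ballSW SWb) (ex_intro2 _ _ x Ox erefl).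
move: hd; rewrite dotvNl dotvDr Eaio [dotv _ x]dotv_trmx; lra.
Qed.
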